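(* Let $A\in\mathbb{R}^{n\times n}$ be symmetric positive definite, and let $S$ be an arbitrary set of multisets of $n$ real numbers. Let $d(X,A)$ be any one of the following three functions, defined for symmetric positive definite $X\in\mathbb{R}^{n\times n}$: (i) $d(X,A)=\mathrm{tr}(X^{-1}A)-\log\det(X^{-1}A)-n$; (ii) $d(X,A)=\mathrm{tr}(XA^{-1})-\log\det(XA^{-1})-n$; (iii) $d(X,A)=\mathrm{tr}(X^{-1}A)+\mathrm{tr}(XA^{-1})$. Consider the optimization problem $$\min_{X}\ d(X,A)\quad\text{subject to}\quad \mathrm{Eig}(X)\in S,\quad X\succ 0,\ X\in\mathbb{R}^{n\times n}.$$ If this problem has at least one optimal solution, then it has an optimal solution $\widehat X$ with the same eigenvectors as $A$.
   Context: $X\succ0$ means that $X$ is symmetric positive definite. $\mathrm{Eig}(X)$ is the multiset of eigenvalues of $X$, counted with multiplicity. ''$\widehat X$ has the same eigenvectors as $A$'' means that there is an orthonormal basis of $\mathbb{R}^n$ each of whose elements is an eigenvector of both $A$ and $\widehat X$. *)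

(* Defs.v *)
From mathcomp Require Import all_boot all_order all_algebra.
From mathcomp Require Import finmap multiset.
From mathcomp Require polyrcf.
From mathcomp Require Import all_classical all_reals all_analysis.

Set Implicit Arguments.
Unset Strict Implicit.
Unset Printing Implicit Defensive.

Import Order.TTheory GRing.Theory Num.Theory.
Local Open Scope classical_set_scope.
Local Open Scope ring_scope.
Local Open Scope mset_scope.

Section Definitions.
Context {R : realType} {n : nat}.
Implicit Types (A X : 'M[R]_n) (S : set {mset R}).

Definition symposdef X : Prop :=
  X^T = X /\ forall v : 'cV[R]_n, v != 0 -> 0 < (v^T *m X *m v) 0 0.

(* Only the real eigenvalues are recorded, which for symmetric X are all of
   them.  [eigenvalue] refers to left (row) eigenvectors; a matrix and its
   transpose have the same eigenvalues.  Multiplicities are algebraic. *)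
Definition Eig X : {mset R} :=
  [fsfun x in fset_set [set a : R | eigenvalue X a] => mup x (char_poly X)].

(* The losses are total, but only meaningful for positive definite X and A:
   [invmx] returns singular matrices unchanged and [ln] is 0 on nonpositive
   reals. *)
Definition stein_loss X A : R :=
  \tr (invmx X *m A) - ln (\det (invmx X *m A)) - n%:R.

Definition stein_loss_rev X A : R :=
  \tr (X *m invmx A) - ln (\det (X *m invmx A)) - n%:R.

(* The sum of the two losses above, up to the additive constant 2n. *)
Definition sym_stein_loss X A : R := \tr (invmx X *m A) + \tr (X *m invmx A).

Definition feasible S X : Prop := symposdef X /\ S (Eig X).

Definition optimal (d : 'M[R]_n -> 'M[R]_n -> R) S A X : Prop :=
  feasible S X /\ forall Y, feasible S Y -> d X A <= d Y A.

Definition eigenvector X (v : 'cV[R]_n) : Prop :=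
  v != 0 /\ exists a : R, X *m v = a *: v.

Definition orthonormal_basis (b : n.-tuple 'cV[R]_n) : Prop :=
  basis_of fullv b /\
  forall i j : 'I_n, ((tnth b i)^T *m tnth b j) 0 0 = (i == j)%:R.

Definition same_eigenvectors X A : Prop :=
  exists b : n.-tuple 'cV[R]_n, orthonormal_basis b /\
    forall i : 'I_n, eigenvector A (tnth b i) /\ eigenvector X (tnth b i).

End Definitions.

Section EigTheory.
Context {R : realType} {n : nat}.
Implicit Types X : 'M[R]_n.

Lemma finite_eigenvalues X : finite_set [set a : R | eigenvalue X a].
Proof.
have p0 : char_poly X != 0 by rewrite monic_neq0 ?char_poly_monic.
apply: (@sub_finite_set _ _ [set` polyrcf.rootsR (char_poly X)]); last first.
  exact: finite_seq.
move=> a /=; rewrite eigenvalue_root_char => pa.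
by have := polyrcf.roots_on_rootsR p0 a; rewrite pa andbT in_itv /= => <-.
Qed.

Lemma EigE X x : Eig X x = mup x (char_poly X).
Proof.
rewrite fsfunE in_fset_set; last exact: finite_eigenvalues.
have -> : (x \in [set a : R | eigenvalue X a]) = root (char_poly X) x.
  by rewrite -eigenvalue_root_char; apply/idP/idP; rewrite inE.
by case: ifPn => // /mupNroot ->.
Qed.

Lemma Eig_seq_mset X (s : seq R) :
  char_poly X = \prod_(a <- s) ('X - a%:P) -> Eig X = seq_mset s.
Proof.
move=> Xs; apply/msetP => x; rewrite EigE mset_seqE Xs.
by rewrite mu_prod_XsubC.
Qed.

End EigTheory.

(* Main.v *)
(* Diagonalize A = P^T diag(a) P and an optimal X = Q^T diag(x) Q with a and x
   both sorted increasingly, and put Xhat = P^T diag(x) P. Determinants and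
   spectra of X and Xhat agree, and with U = Q P^T,
     tr(X^-1 A) = sum_ij U_ij^2 a_j / x_i,   tr(X A^-1) = sum_ij U_ij^2 x_i / a_j.
   As (U_ij^2) is doubly stochastic and the two factors are oppositely ordered,
   both sums are bounded below by their values at U = 1, which are the traces
   for Xhat. *)
Require Import Defs.
From mathcomp Require Import all_boot all_order all_algebra.
From mathcomp Require Import perm.
From mathcomp Require Import finmap multiset.
From mathcomp Require Import complex.
From mathcomp Require Import zify ring lra.
From mathcomp Require Import all_classical all_reals all_analysis.

Set Implicit Arguments.
Unset Strict Implicit.
Unset Printing Implicit Defensive.

Import Order.TTheory GRing.Theory Num.Theory.
Local Open Scope classical_set_scope.
Local Open Scope ring_scope.

(** * Spectral theorem for real symmetric matrices *)

(** Over the complex numbers the matrix becomes hermitian, so its spectral values are real. A real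
    root of the complexified characteristic polynomial is already a root over [R], the embedding
    being injective. *)
Lemma symmetric_eigenvalue (R : rcfType) n (A : 'M[R]_n.+1) :
  A^T = A -> exists a, eigenvalue A a.
Proof.
move=> symA; pose f : {rmorphism R -> complex R} := real_complex R.
pose B := map_mx f A.
have hermB : B \is hermsymmx.
  apply: realsym_hermsym.
    by apply/is_hermitianmxP; rewrite expr0 scale1r map_mx_id // map_trmx symA.
  apply/mxOverP => i j; rewrite mxE; apply/complex_realP.
  by exists (A i j).
have /mxOverP/(_ 0 0)/complex_realP[a aE] :=
  hermitian_spectral_diag_real hermB.
exists a; rewrite eigenvalue_root_char -(fmorph_root f) map_char_poly.
rewrite -eigenvalue_root_char; apply/eigenvalueP.
exists (row 0 (spectralmx B)).
  have /hermitian_normalmx/orthomx_spectralP BE := hermB.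
  have {}BE : spectralmx B *m B = diag_mx (spectral_diag B) *m spectralmx B.
    by rewrite [X in _ *m X]BE !mulmxA mulmxV ?spectral_unit // mul1mx.
  rewrite -[X in X *: _]aE -row_mul BE row_mul row_diag_mx -scalemxAl.
  by rewrite -rowE.
apply/eqP => row0; have := spectral_unit B.
rewrite -row_free_unit -kermx_eq0 => /eqP ker0.
have : (delta_mx 0 0 : 'rV_n.+1) *m spectralmx B = 0 by rewrite -rowE.
move/eqP; rewrite -sub_kermx ker0 submx0 => /eqP/matrixP/(_ 0 0)/eqP.
by rewrite !mxE eqxx oner_eq0.
Qed.

Lemma dot_self_gt0 (R : realFieldType) n (v : 'rV[R]_n) :
  v != 0 -> 0 < (v *m v^T) 0 0.
Proof.
move=> v0; have /rV0Pn[i vi] := v0.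
rewrite mxE (bigD1 i) //= mxE ltr_pwDl //.
  by rewrite -expr2 exprn_even_gt0.
by apply: sumr_ge0 => j _; rewrite mxE -expr2 sqr_ge0.
Qed.

(** Used to move a coordinate vector onto a unit eigenvector. Symmetry of [H] makes it an
    involution, so that conjugation by [H] preserves symmetric matrices. *)
Lemma orthogonal_transport (R : realFieldType) n (u v : 'rV[R]_n) :
  u *m u^T = v *m v^T ->
  exists H : 'M[R]_n, [/\ H *m H^T = 1%:M, H^T = H & u *m H = v].
Proof.
move=> uv; have [->|neq_uv] := eqVneq u v.
  by exists 1%:M; rewrite trmx1 !mulmx1.
(* The Householder reflection along [u - v]. *)
pose w := u - v; have w_gt0 : 0 < (w *m w^T) 0 0.
  by rewrite dot_self_gt0 // subr_eq0.
set c := (w *m w^T) 0 0 in w_gt0; pose k := 2 / c.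
have ww : w *m w^T = c%:M by rewrite [LHS]mx11_scalar.
have symH : (1%:M - k *: (w^T *m w))^T = 1%:M - k *: (w^T *m w).
  by rewrite linearB /= linearZ /= trmx1 trmx_mul trmxK.
exists (1%:M - k *: (w^T *m w)); split => //.
  have WW : (w^T *m w) *m (w^T *m w) = c *: (w^T *m w).
    by rewrite mulmxA -(mulmxA w^T) ww mul_mx_scalar -scalemxAl.
  rewrite symH; move: (w^T *m w) WW => W WW.
  rewrite mulmxBl mul1mx mulmxBr mulmx1 -!scalemxAl -!scalemxAr WW !scalerA.
  have -> : k * k * c = k + k by rewrite /k; field; rewrite gt_eqF.
  by rewrite scalerDl opprB addrK subrK.
(* Equal norms of [u] and [v] give [w *m w^T = 2 *: (u *m w^T)]; the reflection thus subtracts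
   exactly [w] from [u]. *)
have uw : u *m w^T = (c / 2)%:M.
  have vu : v *m u^T = u *m v^T.
    apply/matrixP => i j; rewrite !ord1 !mxE.
    by apply: eq_bigr => l _; rewrite !mxE mulrC.
  have : w *m w^T = 2 *: (u *m w^T).
    rewrite /w linearB /= mulmxBl !mulmxBr vu uv scaler_nat mulr2n.
    by rewrite opprB addrC.
  rewrite ww => /(congr1 ( *:%R 2^-1)); rewrite scalerA mulVf ?pnatr_eq0 // scale1r.
  by move=> <-; rewrite scale_scalar_mx mulrC.
rewrite mulmxBr mulmx1 -scalemxAr mulmxA uw mul_scalar_mx scalerA /k.
have -> : 2 / c * (c / 2) = 1 by field; rewrite gt_eqF.
by rewrite scale1r /w opprB addrC subrK.
Qed.

(** When [P] is orthogonal, its transposed rows are orthonormal eigenvectors with eigenvalues [d].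
    Orthogonality is assumed separately, as [P *m P^T = 1%:M]. *)
Definition orthodiag (R : comNzRingType) n (P : 'M[R]_n) (d : 'rV[R]_n) :=
  P^T *m diag_mx d *m P.

Lemma orthodiagE (R : comNzRingType) n (P : 'M[R]_n) d i j :
  orthodiag P d i j = \sum_k P k i * d 0 k * P k j.
Proof.
by rewrite mxE; apply: eq_bigr => k _; rewrite mul_mx_diag !mxE.
Qed.

(** Induction on the dimension: a reflection taking the first coordinate vector to a unit
    eigenvector splits off a one-dimensional block and leaves a smaller symmetric one. *)
Lemma symmetric_orthodiag (R : rcfType) n (A : 'M[R]_n) : A^T = A ->
  exists P d, P *m P^T = 1%:M /\ A = orthodiag P d.
Proof.
elim: n A => [|n IHn] A symA.
  by exists 1%:M, 0; split; apply/matrixP => -[].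
have [a /eigenvalueP[v vA v0]] := symmetric_eigenvalue symA.
have c_gt0 := dot_self_gt0 v0; set c := (v *m v^T) 0 0 in c_gt0.
pose u := (Num.sqrt c)^-1 *: v.
have uA : u *m A = a *: u by rewrite -scalemxAl vA !scalerA mulrC.
pose e : 'rV[R]_n.+1 := delta_mx 0 0.
have eu : e *m e^T = u *m u^T.
  rewrite linearZ /= -scalemxAl -scalemxAr scalerA [v *m _]mx11_scalar -/c.
  rewrite scale_scalar_mx -invfM -expr2 sqr_sqrtr ?ltW // mulVf ?gt_eqF //.
  by rewrite trmx_delta mul_delta_mx; apply/matrixP => i j; rewrite !ord1 !mxE.
have [H [HH symH eH]] := orthogonal_transport eu.
have HH' : H *m H = 1%:M by rewrite -{2}symH.
(* The dimension is written [1 + n] for the block decomposition, and [B] is kept folded. *)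
have [B defB] : {B : 'M[R]_(1 + n) | B = H *m A *m H} by exists (H *m A *m H).
have symB : B^T = B by rewrite defB !trmx_mul symH symA mulmxA.
have eB : e *m B = a *: e.
  by rewrite defB !mulmxA eH uA -scalemxAl -eH -mulmxA HH' mulmx1.
have B0 j : B 0 j = a * (0 == j)%:R.
  by move/rowP/(_ j) : eB; rewrite -rowE !mxE eqxx /= eq_sym.
(* The first row of [B] is known from [eB], the first column by symmetry. *)
have BE : B = block_mx a%:M 0 0 (drsubmx B).
  rewrite -[LHS]submxK; congr block_mx; apply/matrixP => i j.
  - by rewrite !ord1 !mxE lshift0 B0 mulr1 mulr1n.
  - by rewrite !ord1 !mxE lshift0 B0 mulr0.
  - by rewrite -symB !ord1 !mxE lshift0 B0 mulr0.
have [|Q [d [QQ dE]]] := IHn (drsubmx B).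
  by rewrite -[in RHS]symB trmx_drsub.
pose Q1 : 'M[R]_(1 + n) := block_mx 1%:M 0 0 Q.
have QQ1 : Q1 *m Q1^T = 1%:M.
  rewrite tr_block_mx mulmx_block !trmx0 trmx1.
  by rewrite !(mulmx0, mul0mx, mulmx1, addr0, add0r) QQ -scalar_mx_block.
have {}BE : B = orthodiag Q1 (row_mx a%:M d).
  rewrite BE dE /orthodiag diag_mx_row tr_block_mx !mulmx_block.
  have -> : diag_mx (a%:M : 'rV_1) = a%:M.
    by apply/matrixP => i j; rewrite !ord1 !mxE.
  by rewrite !trmx0 trmx1 !(mulmx0, mul0mx, mulmx1, mul1mx, addr0, add0r).
exists (Q1 *m H), (row_mx a%:M d); split.
  by rewrite trmx_mul mulmxA -(mulmxA _ H) HH mulmx1.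
have -> : A = H *m B *m H.
  by rewrite defB !mulmxA HH' mul1mx -mulmxA HH' mulmx1.
by rewrite BE /orthodiag trmx_mul symH !mulmxA.
Qed.

(** Permuting the rows of [P] together with the entries of [d] does not change the matrix. *)
Lemma symmetric_sorted_orthodiag (R : rcfType) n (A : 'M[R]_n) : A^T = A ->
  exists P d, [/\ P *m P^T = 1%:M, A = orthodiag P d &
                  {homo d 0 : i j / (i <= j)%N >-> i <= j}].
Proof.
move=> /symmetric_orthodiag[P [d [PP ->]]].
pose t := [tuple d 0 i | i < n].
have szs : size (sort <=%O t) == n by rewrite size_sort size_tuple.
have /tuple_permP[s sE] : perm_eq (sort <=%O t) t by rewrite perm_sort.
have dE i : d 0 (s i) = nth 0 (sort <=%O t) i.
  by rewrite sE -tnth_nth !tnth_mktuple.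
exists (row_perm s P), (\row_i d 0 (s i)); split.
- rewrite row_permE trmx_mul mulmxA -(mulmxA _ P) PP mulmx1 tr_perm_mx.
  by rewrite -perm_mxM mulgV perm_mx1.
- apply/matrixP => i j; rewrite !orthodiagE (reindex_inj (@perm_inj _ s)) /=.
  by apply: eq_bigr => k _; rewrite !mxE.
- move=> i j ij; rewrite !mxE !dE; apply: sorted_leq_nth => //.
  + exact: le_trans.
  + exact: sort_le_sorted.
  + by rewrite inE (eqP szs).
  + by rewrite inE (eqP szs).
Qed.

(** * Rearrangement inequality for doubly stochastic weights *)

(** [u] is a discrete Stieltjes integral of [f] against [g], and equality on the diagonal dictates
    [v]. What remains is [u i - u j <= (g i - g j) * f j]: the increments of [g] are nonpositive,
    while [f] is at least [f j] after [j] and at most [f j] before it. *)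
Lemma antitone_potentials (R : realDomainType) (f g : nat -> R) :
  {homo f : i j / (i <= j)%N >-> i <= j} ->
  {homo g : i j / (i <= j)%N >-> j <= i} ->
  exists u v : nat -> R, (forall i j, u i + v j <= g i * f j) /\
                         forall i, u i + v i = g i * f i.
Proof.
move=> f_homo g_homo; pose u i := \sum_(k < i) (g k.+1 - g k) * f k.
have uS i : u i.+1 = u i + (g i.+1 - g i) * f i by rewrite /u big_ord_recr.
have u_up j m : u (j + m)%N - u j <= (g (j + m)%N - g j) * f j.
  elim: m => [|m IHm]; first by rewrite addn0 !subrr mul0r.
  have := f_homo j (j + m)%N (leq_addr _ _).
  have := g_homo (j + m)%N (j + m).+1 (leqnSn _).
  by rewrite addnS uS; move: IHm; nra.
have u_down i m : u i - u (i + m)%N <= (g i - g (i + m)%N) * f (i + m)%N.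
  elim: m => [|m IHm]; first by rewrite addn0 !subrr mul0r.
  have := f_homo (i + m)%N (i + m).+1 (leqnSn _).
  have := g_homo i (i + m).+1 (leqW (leq_addr _ _)).
  by rewrite addnS uS; move: IHm; nra.
exists u, (fun j => g j * f j - u j); split=> [i j|i]; last by ring.
suff : u i - u j <= (g i - g j) * f j by lra.
have [le_ij|/ltnW le_ji] := leqP i j; first by rewrite -(subnKC le_ij).
by rewrite -(subnKC le_ji).
Qed.

(* The potentials are feasible for the dual of the linear program of minimizing
   over doubly stochastic matrices, and tight on the identity. *)
Lemma doubly_stochastic_rearrangement (R : realDomainType) n (W : 'M[R]_n)
    (f g : 'I_n -> R) :
  (forall i j, 0 <= W i j) ->
  (forall i, \sum_j W i j = 1) -> (forall j, \sum_i W i j = 1) ->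
  {homo f : i j / (i <= j)%N >-> i <= j} ->
  {homo g : i j / (i <= j)%N >-> j <= i} ->
  \sum_i g i * f i <= \sum_i \sum_j W i j * (g i * f j).
Proof.
case: n => [|n] in W f g *; first by rewrite !big_ord0.
(* Truncating indices at [n] extends [f] and [g] to all naturals while keeping them monotone. *)
move=> W0 Wr Wc f_homo g_homo; pose h (k : nat) : 'I_n.+1 := inord (minn k n).
have hK (i : 'I_n.+1) : h i = i.
  by apply/val_inj; rewrite /= inordK; have := ltn_ord i; lia.
have h_homo i j : (i <= j)%N -> (h i <= h j)%N.
  by move=> ij; rewrite !inordK; lia.
have [u [v [uv_le uv_eq]]] := @antitone_potentials R (f \o h) (g \o h)
  (fun i j ij => f_homo _ _ (h_homo i j ij))
  (fun i j ij => g_homo _ _ (h_homo i j ij)).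
(* Row and column sums equal to 1 let the weights be inserted into the sum of the potentials, which
   is tight on the diagonal. *)
have -> : \sum_i g i * f i = \sum_i \sum_j W i j * (u i + v j).
  under [RHS]eq_bigr do under eq_bigr do rewrite mulrDr.
  under [RHS]eq_bigr do rewrite big_split /= -mulr_suml Wr mul1r.
  rewrite big_split /= [X in _ + X]exchange_big /=.
  under [X in _ + X]eq_bigr do rewrite -mulr_suml Wc mul1r.
  by rewrite -big_split /=; apply: eq_bigr => i _; rewrite uv_eq /= hK.
apply: ler_sum => i _; apply: ler_sum => j _; apply: ler_wpM2l => //.
by have := uv_le i j; rewrite /= !hK.
Qed.

(** * Traces, inverses, determinants and spectra of orthogonally diagonalized matrices *)

Section Orthodiag.
Variables (R : realFieldType) (n : nat).
Implicit Types (P Q : 'M[R]_n) (d e : 'rV[R]_n).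

Lemma mxtrace_orthodiag P Q d e :
  \tr (orthodiag Q e *m orthodiag P d) =
  \sum_i \sum_j (Q *m P^T) i j ^+ 2 * (e 0 i * d 0 j).
Proof.
have -> : orthodiag Q e *m orthodiag P d =
    Q^T *m (diag_mx e *m (Q *m P^T) *m diag_mx d *m P).
  by rewrite /orthodiag !mulmxA.
(* Cyclicity of the trace leaves only the transition matrix [Q *m P^T] between the two
   eigenbases. *)
rewrite mxtrace_mulC; have -> : diag_mx e *m (Q *m P^T) *m diag_mx d *m P *m Q^T =
    diag_mx e *m (Q *m P^T) *m diag_mx d *m (Q *m P^T)^T.
  by rewrite trmx_mul trmxK !mulmxA.
move: (Q *m P^T) => U; apply: eq_bigr => i _; rewrite mxE.
by apply: eq_bigr => j _; rewrite mul_mx_diag mxE mul_diag_mx !mxE; ring.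
Qed.

Lemma mxtrace_orthodiag_diag P d e : P *m P^T = 1%:M ->
  \tr (orthodiag P e *m orthodiag P d) = \sum_i e 0 i * d 0 i.
Proof.
move=> PP; rewrite mxtrace_orthodiag PP; apply: eq_bigr => i _.
rewrite (bigD1 i) //= mxE eqxx expr1n mul1r big1 ?addr0 // => j ji.
by rewrite mxE eq_sym (negPf ji) expr0n mul0r.
Qed.

Lemma mxtrace_orthodiag_ge P Q d e :
  P *m P^T = 1%:M -> Q *m Q^T = 1%:M ->
  {homo d 0 : i j / (i <= j)%N >-> i <= j} ->
  {homo e 0 : i j / (i <= j)%N >-> j <= i} ->
  \sum_i e 0 i * d 0 i <= \tr (orthodiag Q e *m orthodiag P d).
Proof.
move=> PP QQ d_homo e_homo; rewrite mxtrace_orthodiag.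
have UU : (Q *m P^T) *m (Q *m P^T)^T = 1%:M.
  by rewrite trmx_mul trmxK mulmxA -(mulmxA Q) (mulmx1C PP) mulmx1.
move: (Q *m P^T) UU => U UU; have UU' := mulmx1C UU.
(* The diagonals of [U *m U^T] and [U^T *m U] give the row and column sums of [W]. *)
pose W : 'M[R]_n := \matrix_(i, j) U i j ^+ 2.
apply: le_trans (@doubly_stochastic_rearrangement R n W _ _ _ _ _ d_homo e_homo) _.
- by move=> i j; rewrite mxE sqr_ge0.
- move=> i; move/matrixP/(_ i i) : UU; rewrite !mxE eqxx mulr1n => <-.
  by apply: eq_bigr => j _; rewrite !mxE expr2.
- move=> j; move/matrixP/(_ j j) : UU'; rewrite !mxE eqxx mulr1n => <-.
  by apply: eq_bigr => i _; rewrite !mxE expr2.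
- by apply: ler_sum => i _; apply: ler_sum => j _; rewrite mxE.
Qed.

Lemma invmx_orthodiag P d : P *m P^T = 1%:M -> (forall i, d 0 i != 0) ->
  invmx (orthodiag P d) = orthodiag P (\row_i (d 0 i)^-1).
Proof.
move=> PP d0; set M := orthodiag P d; set N := orthodiag P _.
have MN : M *m N = 1%:M.
  rewrite /M /N /orthodiag !mulmxA -(mulmxA _ P) PP mulmx1.
  rewrite -(mulmxA _ (diag_mx d)) mulmx_diag.
  have -> : \row_j (d 0 j * (\row_i (d 0 i)^-1) 0 j) = const_mx 1 :> 'rV[R]_n.
    by apply/rowP => i; rewrite !mxE divff.
  by rewrite diag_const_mx mulmx1 (mulmx1C PP).
by have [uM _] := mulmx1_unit MN; rewrite -[LHS]mulmx1 -MN mulKmx.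
Qed.

Lemma det_orthodiag P d : P *m P^T = 1%:M ->
  \det (orthodiag P d) = \prod_i d 0 i.
Proof.
move=> PP; rewrite /orthodiag !det_mulmx mulrAC mulrC -det_mulmx mulmx1C //.
by rewrite det1 mulr1 det_diag.
Qed.

Lemma char_poly_orthodiag P d : P *m P^T = 1%:M ->
  char_poly (orthodiag P d) = char_poly (diag_mx d).
Proof.
move=> PP; have PP' : map_mx polyC P^T *m map_mx polyC P = 1%:M.
  by rewrite -map_mxM mulmx1C // map_mx1.
rewrite /char_poly /char_poly_mx /orthodiag !map_mxM /=.
(* The scalar matrix ['X%:M] is invariant under orthogonal conjugation, so the whole characteristic
   matrix is a conjugate. *)
have -> : 'X%:M - map_mx polyC P^T *m map_mx polyC (diag_mx d) *m map_mx polyC P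
    = map_mx polyC P^T *m ('X%:M - map_mx polyC (diag_mx d)) *m map_mx polyC P.
  by rewrite mulmxBr mulmxBl mul_mx_scalar -scalemxAl PP' scalemx1.
by rewrite !det_mulmx mulrAC mulrC -det_mulmx PP' det1 mulr1.
Qed.

Lemma orthodiag_form P d (v : 'cV[R]_n) :
  (v^T *m orthodiag P d *m v) 0 0 = \sum_i d 0 i * (P *m v) i 0 ^+ 2.
Proof.
have -> : v^T *m orthodiag P d *m v = (P *m v)^T *m diag_mx d *m (P *m v).
  by rewrite /orthodiag trmx_mul !mulmxA.
rewrite mxE; apply: eq_bigr => i _; rewrite mul_mx_diag !mxE; ring.
Qed.

Lemma mul_tr_row_orthogonal P i : P *m P^T = 1%:M ->
  P *m (row i P)^T = delta_mx i 0.
Proof. by move=> PP; rewrite tr_row colE mulmxA PP mul1mx. Qed.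

Lemma mul_orthodiag_row P d i : P *m P^T = 1%:M ->
  orthodiag P d *m (row i P)^T = d 0 i *: (row i P)^T.
Proof.
move=> PP; rewrite /orthodiag -mulmxA mul_tr_row_orthogonal // -mulmxA.
have -> : diag_mx d *m delta_mx i 0 = d 0 i *: (delta_mx i 0 : 'cV_n).
  apply/matrixP => j k; rewrite mul_diag_mx !mxE.
  by case: eqVneq => [->|]; rewrite //= !mulr0.
by rewrite -scalemxAr tr_row colE.
Qed.

End Orthodiag.

(** * Positive definiteness and common eigenvectors *)

(** The quadratic form is diagonal in the coordinates [P *m v]; evaluating it at a transposed row of
    [P] isolates one entry of [d]. *)
Lemma symposdef_orthodiag (R : realType) n (P : 'M[R]_n) d : P *m P^T = 1%:M ->
  symposdef (orthodiag P d) <-> forall i, 0 < d 0 i.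
Proof.
move=> PP; split=> [[_ posM] i|d_gt0].
  have Pi := mul_tr_row_orthogonal i PP.
  have := posM (row i P)^T; rewrite orthodiag_form Pi (bigD1 i) //= mxE !eqxx.
  rewrite expr1n mulr1 big1 ?addr0; last first.
    by move=> j ji; rewrite mxE (negPf ji) expr0n mulr0.
  apply; apply/eqP => Pi0; move: Pi; rewrite Pi0 mulmx0 => /matrixP/(_ i 0)/eqP.
  by rewrite !mxE !eqxx eq_sym oner_eq0.
split=> [|v v0]; first by rewrite /orthodiag !trmx_mul trmxK tr_diag_mx mulmxA.
rewrite orthodiag_form; have Pv0 : P *m v != 0.
  apply: contra_neq v0 => Pv.
  by rewrite -[LHS]mul1mx -(mulmx1C PP) -mulmxA Pv mulmx0.
have /cV0Pn[i Pvi] := Pv0.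
rewrite (bigD1 i) //=; apply: ltr_pwDl.
  by rewrite mulr_gt0 ?exprn_even_gt0.
by apply: sumr_ge0 => j _; rewrite mulr_ge0 ?sqr_ge0 // ltW.
Qed.

Lemma same_eigenvectors_orthodiag (R : realType) n (P : 'M[R]_n) d e :
  P *m P^T = 1%:M -> same_eigenvectors (orthodiag P d) (orthodiag P e).
Proof.
move=> PP; have b_dot i j : (row i P *m (row j P)^T) 0 0 = (i == j)%:R.
  by rewrite -row_mul mul_tr_row_orthogonal // !mxE eqxx andbT.
exists [tuple (row i P)^T | i < n]; split; last first.
  move=> i; rewrite tnth_mktuple; have vi0 : (row i P)^T != 0.
    apply/eqP => vi; have := b_dot i i; rewrite vi mulmx0 mxE eqxx => /eqP.
    by rewrite eq_sym oner_eq0.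
  by split; split => //; eexists; rewrite mul_orthodiag_row.
split; last by move=> i j; rewrite !tnth_mktuple trmxK b_dot.
rewrite basisEfree subvf size_tuple dimvf dim_matrix mulr1 leqnn !andbT.
apply/freeP => k sum0 i.
have {}sum0 : \sum_j k j *: (row j P)^T = 0.
  by rewrite -[RHS]sum0; apply: eq_bigr => j _; rewrite -tnth_nth tnth_mktuple.
(* Pairing a vanishing combination with [row i P] extracts its coefficient [k i]. *)
have := congr1 (fun v : 'cV_n => (row i P *m v) 0 0) sum0.
rewrite mulmx0 mulmx_sumr summxE (bigD1 i) //= big1 ?addr0.
  by rewrite -scalemxAr mxE b_dot eqxx mulr1 mxE.
move=> j ji; rewrite -scalemxAr mxE b_dot.
by rewrite eq_sym (negPf ji) mulr0.
Qed.

Lemma Eig_orthodiag (R : realType) n (P Q : 'M[R]_n) d :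
  P *m P^T = 1%:M -> Q *m Q^T = 1%:M ->
  Eig (orthodiag P d) = Eig (orthodiag Q d).
Proof. by move=> PP QQ; apply/msetP => x; rewrite !EigE !char_poly_orthodiag. Qed.

Local Open Scope mset_scope.

Theorem theorem2 (R : realType) (n : nat) (A : 'M[R]_n) (hA : symposdef A)
    (S : set {mset R}) (hS : forall m : {mset R}, S m -> size m = n)
    (d : 'M[R]_n -> 'M[R]_n -> R)
    (hd : [\/ d = stein_loss, d = stein_loss_rev | d = sym_stein_loss]) :
  (exists X : 'M[R]_n, optimal d S A X) ->
  exists Xhat : 'M[R]_n, optimal d S A Xhat /\ same_eigenvectors Xhat A.
Proof.
move=> [X [[posX SX] optX]].
have [P [a [PP AE a_homo]]] := symmetric_sorted_orthodiag hA.1.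
have [Q [x [QQ XE x_homo]]] := symmetric_sorted_orthodiag posX.1.
subst A X.
have a_gt0 := (symposdef_orthodiag _ PP).1 hA.
have x_gt0 := (symposdef_orthodiag _ QQ).1 posX.
have inv_homo (y : 'rV[R]_n) : (forall i, 0 < y 0 i) ->
    {homo y 0 : i j / (i <= j)%N >-> i <= j} ->
    {homo (\row_i (y 0 i)^-1) 0 : i j / (i <= j)%N >-> j <= i}.
  by move=> y_gt0 y_homo i j ij; rewrite !mxE lef_pV2 ?posrE ?y_homo.
have neq0 (y : 'rV[R]_n) : (forall i, 0 < y 0 i) -> forall i, y 0 i != 0.
  by move=> y_gt0 i; rewrite gt_eqF.
exists (orthodiag P x); split; last exact: same_eigenvectors_orthodiag.
split.
  split; first exact/symposdef_orthodiag.
  by rewrite (@Eig_orthodiag _ _ P Q).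
(* As [X] is optimal, it suffices that the new matrix has a loss no larger than that of [X]. *)
move=> Y /optX; apply: le_trans.
have tr1 : \tr (invmx (orthodiag P x) *m orthodiag P a) <=
           \tr (invmx (orthodiag Q x) *m orthodiag P a).
  rewrite !invmx_orthodiag ?mxtrace_orthodiag_diag //.
  - by apply: mxtrace_orthodiag_ge => //; apply: inv_homo.
  - exact: neq0.
  - exact: neq0.
(* Here the reciprocals of [a] form the decreasing factor, hence the swap of the two matrices under
   the trace. *)
have tr2 : \tr (orthodiag P x *m invmx (orthodiag P a)) <=
           \tr (orthodiag Q x *m invmx (orthodiag P a)).
  rewrite invmx_orthodiag //; last exact: neq0.
  rewrite mxtrace_mulC mxtrace_orthodiag_diag // [leRHS]mxtrace_mulC.
  by apply: mxtrace_orthodiag_ge => //; apply: inv_homo.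
have det_eq : \det (orthodiag P x) = \det (orthodiag Q x).
  by rewrite !det_orthodiag.
(* The log-determinant terms agree, so each of the first two losses reduces to one trace inequality;
   the third adds both. *)
case: hd => ->; rewrite /stein_loss /stein_loss_rev /sym_stein_loss.
- by rewrite 2!(det_mulmx (invmx _)) 2!det_inv det_eq !lerD2r.
- by rewrite 2!(det_mulmx _ (invmx _)) det_eq !lerD2r.
- exact: lerD.
Qed.
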